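(* Let $G$ be a Polish group and $\Gamma$ a countable group. Then the set \[ \{\pi \in \mathrm{Hom}(\Gamma, G) : \pi(\Gamma) \text{ is extremely amenable}\} \] is a $G_\delta$ subset of $\mathrm{Hom}(\Gamma, G)$.
   Context: $\mathrm{Hom}(\Gamma,G)$ denotes the set of all group homomorphisms $\Gamma\to G$, viewed as a closed subspace of the Polish space $G^\Gamma$ (product topology); it is a Polish space. A topological group is extremely amenable if every continuous action of it on a compact Hausdorff space has a fixed point. Here $\pi(\Gamma)$ carries the subspace topology from $G$. *)

(* Defs.v *)
From HB Require Import structures.
From mathcomp Require Import all_boot all_order all_algebra.
From mathcomp Require Import all_classical all_reals all_analysis.
From mathcomp Require Import Rstruct Rstruct_topology.

Set Implicit Arguments.
Unset Strict Implicit.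
Unset Printing Implicit Defensive.

Import Order.TTheory GRing.Theory Num.Theory.
Local Open Scope classical_set_scope.
Local Open Scope ring_scope.

Definition compatible_metric (T : topologicalType) (d : T -> T -> Rdefinitions.R) :=
  [/\ (forall x y, 0 <= d x y),
      (forall x y, d x y = 0 <-> x = y),
      (forall x y, d x y = d y x),
      (forall x y z, d x z <= d x y + d y z) &
      (forall A : set T, open A <->
         (forall x, A x -> exists2 e : Rdefinitions.R, 0 < e & [set y | d x y < e] `<=` A))].

Definition complete_metric (T : topologicalType) (d : T -> T -> Rdefinitions.R) :=
  forall u : nat -> T,
    (forall e : Rdefinitions.R, 0 < e ->
       exists N : nat, forall m n : nat, leq N m -> leq N n -> d (u m) (u n) < e) ->
    exists l : T, u @ \oo --> l.

Definition polish_space (T : topologicalType) :=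
  (exists D : set T, countable D /\ dense D) /\
  (exists d : T -> T -> Rdefinitions.R, compatible_metric d /\ complete_metric d).

Definition group_axioms (T : Type) (mul : T -> T -> T) (inv : T -> T) (one : T) :=
  [/\ (forall x y z, mul x (mul y z) = mul (mul x y) z),
      (forall x, mul one x = x),
      (forall x, mul x one = x),
      (forall x, mul (inv x) x = one) &
      (forall x, mul x (inv x) = one)].

Definition topological_group (G : topologicalType) (mul : G -> G -> G) (inv : G -> G) (one : G) :=
  group_axioms mul inv one /\
  continuous (fun p : G * G => mul p.1 p.2) /\ continuous inv.

Definition polish_group (G : topologicalType) (mul : G -> G -> G) (inv : G -> G) (one : G) :=
  topological_group mul inv one /\ polish_space G.

Definition hom_set (Gam : Type) (gmul : Gam -> Gam -> Gam) (G : topologicalType)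
    (mul : G -> G -> G) : set {ptws Gam -> G} :=
  [set f | forall a b : Gam, f (gmul a b) = mul (f a) (f b)].

(* A subgroup H of G, with the subspace topology, is extremely amenable:
   every continuous action of H on a (nonempty) compact Hausdorff space has a fixed
   point.  An action of H is given by a : G -> X -> X, only its values on H matter;
   continuity is of (h, x) |-> a h x on H x X with the subspace (= product) topology. *)
Definition extremely_amenable_subgroup (G : topologicalType) (mul : G -> G -> G)
    (one : G) (H : set G) :=
  forall (X : topologicalType),
    [set: X] !=set0 -> compact [set: X] -> hausdorff_space X ->
    forall a : G -> X -> X,
      (forall x, a one x = x) ->
      (forall g h x, H g -> H h -> a (mul g h) x = a g (a h x)) ->
      {within H `*` [set: X], continuous (fun p : G * X => a p.1 p.2)} ->
      exists x : X, forall h, H h -> a h x = x.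

Definition G_delta_in (T : topologicalType) (Y S : set T) :=
  exists U : nat -> set T, (forall n, open (U n)) /\ S = Y `&` \bigcap_n U n.

(* Main.v *)
(** A subgroup [H] is extremely amenable iff it has a Ramsey property: for each
    neighbourhood [U] of [1], each finite covering of [H] by colours and each
    finite [F] in [H], some left translate [h F] lies in [A U] for a single
    colour class [A]. If [H] acts without fixed point on a compact space, finitely
    many sets, each moved off itself by some element of [H], cover the space, and
    colouring [g] by the place of [g^-1 x0] violates the Ramsey property.
    Conversely, left uniformly continuous functions separating each colour class
    [A] from the complement of [A U] generate, under translation, a compact
    [H]-space, in which a fixed point is a tuple of functions constant on [H].
    For [H = pi(Gam)] a compactness argument over the colourings lets a finite
    subset of [Gam] witness the Ramsey property, and this is an open condition
    on [pi]; since [G] is first countable, countably many such conditions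
    suffice. *)

Require Import Defs.
From HB Require Import structures.
From mathcomp Require Import all_boot all_order all_algebra.
From mathcomp Require Import all_classical all_reals all_analysis.
From mathcomp Require Import Rstruct Rstruct_topology lra zify.

Set Implicit Arguments.
Unset Strict Implicit.
Unset Printing Implicit Defensive.

Import Order.TTheory GRing.Theory Num.Theory.
Import numFieldNormedType.Exports.
Local Open Scope classical_set_scope.
Local Open Scope ring_scope.

Local Notation R := Rdefinitions.R.

(** * Pointwise limits, ultrafilters and compactness *)

Lemma initial_cvgP {S : choiceType} {T : topologicalType} (f : S -> T)
    (F : set_system S) (s : S) : Filter F ->
  F --> (s : initial_topology f) <-> f @ F --> f s.
Proof.
move=> FF; split=> [Fs|fFs A [B [[C oC <-] Cs CA]]].
  by apply: cvg_trans (@initial_continuous _ _ f s); exact: cvg_app.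
by apply: filterS CA _; apply: fFs; exact: open_nbhs_nbhs.
Qed.

Lemma ptws_cvgP {I : Type} {V : topologicalType} (F : set_system (I -> V))
    (f : I -> V) : Filter F ->
  {ptws, F --> f} <-> forall i, (fun g => g i) @ F --> f i.
Proof.
move=> FF; split=> [/cvg_sup Ff i|Ff].
  have Fi := Ff i.
  apply: cvg_trans (@initial_continuous _ _ (fun g : I -> V => g i) f).
  exact: cvg_app.
apply/cvg_sup => i.
exact/(@initial_cvgP _ _ (fun g : I -> V => g i) F f).
Qed.

Lemma filter_forall_seq {T : Type} {I : eqType} (F : set_system T) {FF : Filter F}
    (s : seq I) (P : I -> set T) : (forall i, i \in s -> F (P i)) ->
  F [set x | forall i, i \in s -> P i x].
Proof.
elim: s => [|i s IH] sP; first by apply: filterE.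
have sF : F [set x | forall i, i \in s -> P i x].
  by apply: IH => j js; apply: sP; rewrite in_cons js orbT.
apply: filterS2 sF (sP i (mem_head _ _)) => x sx ix j.
by rewrite in_cons => /orP[/eqP->|/sx].
Qed.

Lemma ultra_finite_partition {T : Type} (F : set_system T) (c : T -> nat) k :
  UltraFilter F -> (forall x, (c x < k)%N) ->
  exists2 i, (i < k)%N & F [set x | c x = i].
Proof.
move=> FU ck; have : F [set x | (c x < k)%N] by exact: filterE.
elim: k {ck} => [F0|k IH Fk].
  by have [x] := filter_ex F0.
have [Fc|Fc] := in_ultra_setVsetC [set x | c x = k] FU; first by exists k.
have /IH[i ik Fi] : F [set x | (c x < k)%N].
  apply: filterS2 Fk Fc => x /= xk /eqP nk.
  by rewrite ltn_neqAle nk -ltnS.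
by exists i => //; exact: ltnW.
Qed.

Lemma countable_enum {T : Type} (x0 : T) : countable [set: T] ->
  exists e : nat -> T, forall x, exists n, e n = x.
Proof.
move=> /countable_injP[f finj].
have /choice[e eP] : forall n, exists x, forall y, f y = n -> x = y.
  move=> n; have [[x fx]|nx] := pselect (exists x, f x = n).
    by exists x => y fy; apply: finj; rewrite ?inE// fx.
  by exists x0 => y fy; case: nx; exists y.
by exists e => x; exists (f x); exact: eP.
Qed.

(** First countability at the identity reduces the Ramsey property, a condition on all its
    neighbourhoods, to countably many conditions. *)
Lemma compatible_metric_ball_basis {T : topologicalType} (d : T -> T -> R) (x : T) :
  compatible_metric d -> exists V : nat -> set T,
    (forall n, open_nbhs x (V n)) /\
    (forall U, nbhs x U -> exists n, V n `<=` U).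
Proof.
move=> [d0 dE dC dD dO]; exists (fun n => [set y | d x y < n.+1%:R^-1]).
split=> [n|U].
  split; last by rewrite /= (dE x x).2 // invr_gt0.
  apply/dO => y /= xy; exists (n.+1%:R^-1 - d x y); first by rewrite subr_gt0.
  by move=> z /= yz; apply: le_lt_trans (dD x y z) _; rewrite -ltrBrDl.
rewrite nbhsE => -[B [/dO oB Bx] BU]; have [e e0 eB] := oB _ Bx.
exists (Num.trunc e^-1) => y /= xy; apply/BU/eB => /=; apply: lt_trans xy _.
by rewrite invf_plt ?posrE //; exact: truncnS_gt.
Qed.

Lemma cvg_distP {T : Type} (F : set_system T) {FF : Filter F} (f : T -> R) (l : R) :
  f @ F --> l <-> forall e : R, 0 < e -> \forall t \near F, `|l - f t| < e.
Proof. exact: (@cvgrPdist_lt R R^o). Qed.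

Lemma compact_finite_subcover {X : topologicalType} (O : X -> set X) (x0 : X) :
  compact [set: X] -> (forall x, open_nbhs x (O x)) ->
  exists s : seq X, forall x, exists2 y, y \in s & O y x.
Proof.
move=> cX Oo.
pose T : ptopologicalType := HB.pack X (isPointed.Build X x0).
have : cover_compact [set: T] by rewrite -compact_cover.
move=> /(_ X setT O) [x _||D _ sD]; first by have [] := Oo x.
  by move=> x _; exists x => //; have [] := Oo x.
exists (finmap.enum_fset D) => x; have [y Dy Oyx] := sD x I.
by exists y.
Qed.

Lemma compact_set_type {T : topologicalType} (A : set T) :
  compact A -> compact [set: A].
Proof.
move=> cA F FF _.
have FA : (set_val @ F) A.
  by apply: (@filterE _ F) => -[x xA]; exact: set_mem xA.
have [p [Ap Fp]] := cA _ _ FA.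
exists (exist _ p (mem_set Ap)); split => // B C FB [D [[E oE <-] Ep] EC].
have [_ [[y By <-] Ey]] : (set_val @` B) `&` E !=set0.
  apply: Fp; last exact: open_nbhs_nbhs.
  by apply: (@filterS _ F _ B) => // y By; exists y.
by exists y; split => //; exact: EC.
Qed.

Lemma hausdorff_set_type {T : topologicalType} (A : set T) :
  hausdorff_space T -> hausdorff_space A.
Proof.
move=> hT p q pq; apply: val_inj; apply: hT => B C Bp Cq.
have [x [Bx Cx]] := pq (set_val @^-1` B) (set_val @^-1` C)
  (initial_continuous Bp) (initial_continuous Cq).
by exists (set_val x).
Qed.

(** * Dyadic lengths of chains *)

Definition dyadic_weight (l : seq nat) : R := \sum_(n <- l) 2^-1 ^+ n.

Lemma dyadic_gt0 n : 0 < 2^-1 ^+ n :> R.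
Proof. by rewrite exprn_gt0 // invr_gt0. Qed.

Lemma dyadic_weight_ge0 l : 0 <= dyadic_weight l.
Proof. by apply: sumr_ge0 => n _; exact/ltW/dyadic_gt0. Qed.

Lemma dyadic_weight_cons n l :
  dyadic_weight (n :: l) = 2^-1 ^+ n + dyadic_weight l.
Proof. by rewrite /dyadic_weight big_cons. Qed.

Lemma dyadic_weight_cat l1 l2 :
  dyadic_weight (l1 ++ l2) = dyadic_weight l1 + dyadic_weight l2.
Proof. by rewrite /dyadic_weight big_cat. Qed.

(** Selects the entry at which the partial sums pass [t]; with [t] half the total, each end weighs
    at most half. *)
Lemma dyadic_weight_split l (t : R) : 0 <= t < dyadic_weight l ->
  exists l1 n l2, [/\ l = l1 ++ n :: l2, dyadic_weight l1 <= t &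
    t < dyadic_weight l1 + 2^-1 ^+ n].
Proof.
elim: l t => [|n l IH] t; first by rewrite /dyadic_weight big_nil; lra.
rewrite dyadic_weight_cons => /andP[t0 tl]; have [tn|nt] := ltP t (2^-1 ^+ n).
  by exists [::], n, l; rewrite /dyadic_weight big_nil; split=> //; lra.
have /IH[l1 [m [l2 [-> l1t tm]]]] : 0 <= t - 2^-1 ^+ n < dyadic_weight l by lra.
by exists (n :: l1), m, l2; rewrite dyadic_weight_cons; split => //; lra.
Qed.

(** * Uniformly continuous separation in a topological group *)

Section TopologicalGroup.
Context {G : topologicalType} {mul : G -> G -> G} {inv : G -> G} {one : G}.
Hypothesis tG : topological_group mul inv one.

Let mulA x y z : mul x (mul y z) = mul (mul x y) z.
Proof. by case: tG => -[]. Qed.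
Let mul1 x : mul one x = x. Proof. by case: tG => -[]. Qed.
Let mulr1 x : mul x one = x. Proof. by case: tG => -[]. Qed.
Let mulV x : mul (inv x) x = one. Proof. by case: tG => -[]. Qed.
Let mulrV x : mul x (inv x) = one. Proof. by case: tG => -[]. Qed.
Let mulKV x y : mul x (mul (inv x) y) = y.
Proof. by rewrite mulA mulrV mul1. Qed.
Let mulVK x y : mul (inv x) (mul x y) = y.
Proof. by rewrite mulA mulV mul1. Qed.
Let invK x : inv (inv x) = x.
Proof. by rewrite -[RHS](mulVK (inv x)) mulV mulr1. Qed.
Let invM x y : inv (mul x y) = mul (inv y) (inv x).
Proof.
by rewrite -[RHS](mulVK (mul x y)) -mulA mulKV mulrV mulr1.
Qed.

Lemma cvg_mul {T : Type} (F : set_system T) (f g : T -> G) x y : Filter F ->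
  f @ F --> x -> g @ F --> y -> (fun t => mul (f t) (g t)) @ F --> mul x y.
Proof.
move=> FF fx gy; case: tG => _ [cm _].
exact: cvg_comp (cvg_pair fx gy) (cm (x, y)).
Qed.

Lemma cvg_inv {T : Type} (F : set_system T) (f : T -> G) x : Filter F ->
  f @ F --> x -> (fun t => inv (f t)) @ F --> inv x.
Proof. by move=> FF fx; case: tG => _ [_ ci]; apply: cvg_comp fx (ci x). Qed.

Let inv1 : inv one = one. Proof. by rewrite -[LHS]mulr1 mulV. Qed.

(** Continuity of the triple product at the identity gives a neighbourhood; intersecting it with its
    inverse makes it symmetric. *)
Lemma nbhs_one_cube_root (U : set G) : nbhs one U -> exists W : set G,
  [/\ nbhs one W, forall x, W x -> W (inv x) &
    forall x y z, W x -> W y -> W z -> U (mul x (mul y z))].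
Proof.
move=> U1.
have : (fun p : G * (G * G) => mul p.1 (mul p.2.1 p.2.2)) @
    nbhs (one, (one, one)) --> mul one (mul one one).
  apply: cvg_mul; first exact: cvg_fst.
  by apply: cvg_mul; apply: cvg_comp cvg_snd _; [exact: cvg_fst|exact: cvg_snd].
rewrite !mulr1 => /(_ _ U1)[[A B] /= [A1 [[C D] /= [C1 D1] CDB]] ABU].
pose V := A `&` (C `&` D).
have V1 : nbhs one V by do 2?[apply: filterI => //].
have iV1 : nbhs one (inv @^-1` V).
  by have := @cvg_inv _ (nbhs one) id one _ cvg_id; rewrite inv1; apply.
exists (V `&` inv @^-1` V); split; first exact: filterI.
  by move=> x [Vx iVx]; split => //=; rewrite invK.
move=> x y z [[Ax _] _] [[_ [Cy _]] _] [[_ [_ Dz]] _].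
by apply: (ABU (x, (y, z))); split => //; apply: (CDB (y, z)).
Qed.

Lemma nbhs_one_cube_sequence (U : set G) : nbhs one U ->
  exists W : nat -> set G, [/\ W 0%N `<=` U, forall n, nbhs one (W n),
    forall n x, W n x -> W n (inv x) &
    forall n x y z, W n.+1 x -> W n.+1 y -> W n.+1 z ->
      W n (mul x (mul y z))].
Proof.
move=> /nbhs_one_cube_root[V [V1 Vi VU]].
pose S : set (set G) := [set A | nbhs one A /\ forall x, A x -> A (inv x)].
have /choice[r rP] : forall A : set G, exists B : set G, S A -> S B /\
    forall x y z, B x -> B y -> B z -> A (mul x (mul y z)).
  move=> A; have [[A1 Ai]|nA] := pselect (S A); last by exists A.
  by have [B [B1 Bi BA]] := nbhs_one_cube_root A1; exists B.
(* The sequence starts from the root [V] of [U], since [U] itself need not be symmetric. *)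
pose W n := iter n r V.
have SW n : S (W n) by elim: n => [|n /rP[]].
exists W; split => [x Vx|n|n|n x y z].
- by rewrite -[x]mulr1 -[one]mulr1; apply: VU => //; exact: nbhs_singleton.
- by have [] := SW n.
- by have [] := SW n.
- by have [_] := rP _ (SW n); exact.
Qed.

Section ChainLength.
Variable W : nat -> set G.
Hypothesis W1 : forall n, W n one.
Hypothesis WV : forall n x, W n x -> W n (inv x).
Hypothesis WM : forall n x y z, W n.+1 x -> W n.+1 y -> W n.+1 z ->
  W n (mul x (mul y z)).

Lemma cube_sequence_decreasing m n x : (m <= n)%N -> W n x -> W m x.
Proof.
move=> /subnK <-; elim: (n - m)%N => //= k IH; rewrite addSn => Wx.
by apply: IH; rewrite -[x]mulr1 -[one]mulr1; exact: WM.
Qed.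

(** Membership in the product set [W n1 ... W nk], where [n1, ..., nk] are the entries of [l]. *)
Fixpoint chain_product (l : seq nat) (g : G) : Prop :=
  if l is n :: l' then exists2 x, W n x & chain_product l' (mul (inv x) g)
  else g = one.

Lemma chain_product_cat l1 l2 g : chain_product (l1 ++ l2) g <->
  exists2 x, chain_product l1 x & chain_product l2 (mul (inv x) g).
Proof.
elim: l1 g => [|n l1 IH] g /=.
  by split=> [l2g|[x ->]]; [exists one => //|]; rewrite inv1 mul1.
split=> [[x Wx /IH[y l1y l2g]]|[y [x Wx l1y] l2g]].
  exists (mul x y); first by exists x => //; rewrite mulVK.
  by rewrite invM -mulA.
exists x => //; apply/IH; exists (mul (inv x) y) => //.
by rewrite invM invK -mulA mulKV.
Qed.

Lemma chain_product_rcons l n g w : chain_product l g -> W n w ->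
  chain_product (rcons l n) (mul g w).
Proof.
move=> lg Ww; rewrite -cats1; apply/chain_product_cat; exists g => //=.
by rewrite mulVK; exists w => //; rewrite mulV.
Qed.

(* The chain is cut at half its weight: the two ends and the middle factor all
   lie in [W N.+1], whose cube is contained in [W N]. *)
Lemma chain_product_sub N l g :
  dyadic_weight l < 2^-1 ^+ N -> chain_product l g -> W N g.
Proof.
have [k] := ubnP (size l); elim: k => // k IH in N l g *.
case: l => [|m l] sl lN; first by move=> /= ->.
set L := m :: l in sl lN *.
have L0 : 0 < dyadic_weight L.
  rewrite dyadic_weight_cons ltr_pwDl ?dyadic_gt0 ?dyadic_weight_ge0 //.
have [|l1 [n [l2 [eL l1t tn]]]] := @dyadic_weight_split L (dyadic_weight L / 2).
  by apply/andP; split; lra.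
move: L0 lN sl l1t tn; rewrite eL dyadic_weight_cat dyadic_weight_cons.
rewrite size_cat /= => L0 lN sl l1t tn.
have := dyadic_weight_ge0 l1; have := dyadic_weight_ge0 l2.
have := exprS (2^-1 : R) N => eS p1 p2.
move=> /chain_product_cat[x l1x /= [y Wy l2g]].
have -> : g = mul x (mul y (mul (inv y) (mul (inv x) g))) by rewrite !mulKV.
apply: WM.
- by apply: IH l1x; [lia|lra].
(* An entry [n <= N] would alone weigh at least [2^-1 ^+ N], the strict bound on the whole chain. *)
- apply: cube_sequence_decreasing Wy; rewrite ltnNge; apply/negP => nN.
  have : 2^-1 ^+ N <= 2^-1 ^+ n :> R.
    by apply: ler_wiXn2l => //; lra.
  by lra.
- by apply: IH l2g; [lia|lra].
Qed.

(* The chain construction of the Birkhoff-Kakutani theorem, applied to the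
   distance from [A]; it is cut off at 1. *)
Definition chain_dist (A : set G) (x : G) : R :=
  inf ([set 1] `|` [set r | exists a l,
    [/\ A a, chain_product l (mul (inv a) x) & r = dyadic_weight l]]).

Let chain_dist_lbound A x : has_lbound ([set 1] `|` [set r | exists a l,
    [/\ A a, chain_product l (mul (inv a) x) & r = dyadic_weight l]]).
Proof. by exists 0 => r [->|[a [l [_ _ ->]]]] //; exact: dyadic_weight_ge0. Qed.

Lemma chain_dist_le1 A x : chain_dist A x <= 1.
Proof. by apply: ge_inf => //; left. Qed.

Lemma chain_dist_le A a l x : A a -> chain_product l (mul (inv a) x) ->
  chain_dist A x <= dyadic_weight l.
Proof. by move=> Aa lx; apply: ge_inf => //; right; exists a, l. Qed.

Lemma chain_dist_ge0 A x : 0 <= chain_dist A x.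
Proof.
apply: lb_le_inf; first by exists 1; left.
by move=> r [->|[a [l [_ _ ->]]]] //; exact: dyadic_weight_ge0.
Qed.

Lemma chain_dist_eq0 A a : A a -> chain_dist A a = 0.
Proof.
move=> Aa; apply/eqP; rewrite eq_le chain_dist_ge0 andbT.
have -> : 0 = dyadic_weight [::] by rewrite /dyadic_weight big_nil.
by apply: chain_dist_le Aa _; exact: mulV.
Qed.

(** A value below the cut-off comes from a chain of weight below 1, the zeroth power of 1/2, and
    such a product lies in [W 0]. *)
Lemma chain_dist_lt1 A x : chain_dist A x < 1 ->
  exists2 a, A a & W 0%N (mul (inv a) x).
Proof.
move=> /inf_lt[|r [->|[a [l [Aa lx ->]]]]]; first by exists 1; left.
  by rewrite ltxx.
by move=> l1; exists a => //; apply: chain_product_sub lx.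
Qed.

(** A chain from [A] to [x] followed by one step in [W n] is a chain to [y]. *)
Let chain_dist_leD A n x y : W n (mul (inv x) y) ->
  chain_dist A y <= chain_dist A x + 2^-1 ^+ n.
Proof.
move=> Wxy; rewrite -lerBlDr; apply: lb_le_inf; first by exists 1; left.
move=> r [->|[a [l [Aa lx ->]]]]; rewrite lerBlDr.
  by rewrite (le_trans (chain_dist_le1 A y)) // lerDl ltW ?dyadic_gt0.
have := chain_product_rcons lx Wxy; rewrite -mulA mulKV => lxy.
have := chain_dist_le Aa lxy; rewrite -cats1 dyadic_weight_cat dyadic_weight_cons.
by rewrite [dyadic_weight [::]]big_nil addr0.
Qed.

Lemma chain_dist_uniform A n x y : W n (mul (inv x) y) ->
  `|chain_dist A x - chain_dist A y| <= 2^-1 ^+ n.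
Proof.
move=> Wxy; have Wyx : W n (mul (inv y) x).
  by have := WV Wxy; rewrite invM invK.
by rewrite ler_distl; have := chain_dist_leD A Wxy;
  have := chain_dist_leD A Wyx; lra.
Qed.

End ChainLength.

(** The modulus [V] does not depend on [A]: one neighbourhood has to serve all colour classes at
    once. *)
Lemma uniform_separation (U : set G) : nbhs one U ->
  exists d : set G -> G -> R, [/\ forall A x, 0 <= d A x <= 1,
    forall A a, A a -> d A a = 0,
    forall A x, d A x < 1 -> exists2 a, A a & U (mul (inv a) x) &
    forall e : R, 0 < e -> exists2 V : set G, nbhs one V &
      forall A x y, V (mul (inv x) y) -> `|d A x - d A y| < e].
Proof.
move=> /nbhs_one_cube_sequence[W [WU W1 WV WM]].
have W1' n : W n one by exact: nbhs_singleton.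
exists (chain_dist W); split => [A x|A a|A x|e e0].
- by rewrite chain_dist_ge0 chain_dist_le1.
- exact: chain_dist_eq0.
- by move=> /(chain_dist_lt1 W1' WM)[a Aa /WU]; exists a.
- have [n ne] : exists n, 2^-1 ^+ n < e.
    have : (fun n => 2^-1 ^+ n : R^o) @ \oo --> (0 : R^o).
      by apply: cvg_expr; rewrite ger0_norm; lra.
    move=> /cvgrPdist_lt cv; have [n _ /(_ n (leqnn _))] := cv _ e0.
    by rewrite sub0r normrN ger0_norm ?ltW ?dyadic_gt0 //; exists n.
  exists (W n) => // A x y Wxy.
  exact: le_lt_trans (chain_dist_uniform WV A Wxy) ne.
Qed.

(** * Extreme amenability of a subgroup and its Ramsey property *)

Section Oscillation.
Variable H : set G.
Hypothesis H1 : H one.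
Hypothesis HM : forall x y, H x -> H y -> H (mul x y).
Hypothesis HV : forall x, H x -> H (inv x).

Section OrbitClosure.
Context {I : choiceType}.
Local Notation T := {ptws I * G -> R}.
Variable f : I -> G -> R.
Hypothesis f01 : forall i x, 0 <= f i x <= 1.
Hypothesis fU : forall e : R, 0 < e -> exists2 V : set G, nbhs one V &
  forall i x y, V (mul (inv x) y) -> `|f i x - f i y| < e.

Definition left_shift (h : G) (phi : T) : T :=
  fun p => phi (p.1, mul (inv h) p.2).

(** The whole family [f] is a single point of [T], so that one fixed point in the orbit closure
    serves every index. *)
Definition shift_orbit : set T :=
  [set left_shift h (fun p => f p.1 p.2) | h in H].

Lemma left_shift1 phi : left_shift one phi = phi.
Proof. by apply/funext => -[i x]; rewrite /left_shift inv1 mul1. Qed.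

Lemma left_shiftM g h phi :
  left_shift (mul g h) phi = left_shift g (left_shift h phi).
Proof. by apply/funext => -[i x]; rewrite /left_shift invM mulA. Qed.

Lemma ptws_eval_near (phi : T) p (e : R) : 0 < e ->
  \forall psi \near phi, `|phi p - psi p| < e.
Proof.
move=> e0; have /ptws_cvgP phip : {ptws, nbhs phi --> phi} by [].
exact: (cvg_distP _ _).1 (phip p) e e0.
Qed.

Lemma left_shift_continuous h : continuous (left_shift h).
Proof.
move=> phi; apply/ptws_cvgP => p.
have /ptws_cvgP : {ptws, nbhs phi --> phi} by [].
exact.
Qed.

Lemma closure_orbit_shift h phi : H h -> closure shift_orbit phi ->
  closure shift_orbit (left_shift h phi).
Proof.
move=> Hh cphi B Bphi; have := cphi _ (left_shift_continuous Bphi).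
move=> [_ [[g Hg <-] Bg]]; exists (left_shift h (left_shift g (fun p => f p.1 p.2))).
by split=> //; exists (mul h g); [exact: HM|rewrite left_shiftM].
Qed.

Lemma compact_closure_orbit : compact (closure shift_orbit).
Proof.
pose K : set T := [set phi | forall p, `[0, 1]%classic (phi p)].
have cK : compact K.
  exact: (@tychonoff (I * G)%type (fun=> R) (fun=> `[0, 1]%classic)
    (fun=> @segment_compact R 0 1)).
apply: (subclosed_compact _ cK); first exact: closed_closure.
have /closure_subset : shift_orbit `<=` K.
  by move=> _ [h _ <-] p; rewrite /left_shift /= in_itv /= f01.
move=> /subset_trans; apply; rewrite -(closure_id K).1 //.
apply: compact_closed cK.
exact: (@hausdorff_product (I * G)%type (fun=> R) (fun=> @Rhausdorff R)).
Qed.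

(** Left shifts preserve [x^-1 y], hence the modulus of [f]; approximation at the two points
    [(i, x)] and [(i, y)] carries it to the closure. *)
Lemma closure_orbit_uniform (e : R) : 0 < e -> exists2 V : set G, nbhs one V &
  forall phi, closure shift_orbit phi ->
  forall i x y, V (mul (inv x) y) -> `|phi (i, x) - phi (i, y)| < e.
Proof.
move=> e0; have e30 : 0 < e / 3 by lra.
have [V V1 Vf] := fU e30; exists V => // phi cphi i x y Vxy.
have [_ [[h Hh <-]]] := cphi _ (filterI (ptws_eval_near phi (i, x) e30)
  (ptws_eval_near phi (i, y) e30)).
rewrite /left_shift /= => -[px py].
have : `|f i (mul (inv h) x) - f i (mul (inv h) y)| < e / 3.
  by apply: Vf; rewrite invM invK -mulA mulKV.
move: px py; rewrite !ltr_distl; lra.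
Qed.

Let X : topologicalType := set_type (closure shift_orbit).

(* [insubd] only serves to make the action total: the orbit closure is invariant
   under [left_shift h] when [h] is in [H], and other [h] are irrelevant. *)
Definition orbit_action (h : G) (p : X) : X := insubd p (left_shift h (set_val p)).

Lemma orbit_actionE h (p : X) : H h ->
  set_val (orbit_action h p) = left_shift h (set_val p).
Proof.
move=> Hh; rewrite /orbit_action set_valE val_insubd ifT //.
by apply/mem_set/closure_orbit_shift => //; exact: set_mem (valP p).
Qed.

(** Moving [h] to [g] changes the evaluation point, which [V] controls uniformly over the orbit
    closure; [phi] and [psi] are then compared at the single point [mul (inv h) x]. *)
Lemma orbit_action_continuous :
  {within H `*` [set: X], continuous (fun p : G * X => orbit_action p.1 p.2)}.
Proof.
apply/subspace_continuousP => -[h phi] [/= Hh _].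
apply/(@initial_cvgP _ _ set_val _ (orbit_action h phi)).
apply/ptws_cvgP => -[i x]; apply/cvg_distP => e e0 /=.
have e20 : 0 < e / 2 by lra.
have [V V1 Vphi] := closure_orbit_uniform e20.
have Hnear : \forall p \near within (H `*` [set: X]) (nbhs (h, phi)), H p.1.
  by rewrite near_withinE; apply: nearW => -[g p] [].
have Vnear : \forall p \near within (H `*` [set: X]) (nbhs (h, phi)),
    V (mul (inv (mul (inv h) x)) (mul (inv p.1) x)).
  apply: cvg_within.
  have : mul (inv (mul (inv h) x)) (mul (inv p.1) x) @[p --> nbhs (h, phi)] -->
      mul (inv (mul (inv h) x)) (mul (inv h) x).
    apply: cvg_mul; first exact: cvg_cst.
    by apply: cvg_mul; [apply: cvg_inv; exact: cvg_fst|exact: cvg_cst].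
  by rewrite mulV; exact.
have phinear : \forall p \near within (H `*` [set: X]) (nbhs (h, phi)),
    `|set_val phi (i, mul (inv h) x) - set_val p.2 (i, mul (inv h) x)| < e / 2.
  apply: cvg_within.
  have valphi : (set_val : X -> T) @ phi --> (set_val phi : T).
    exact: initial_continuous.
  exact: cvg_comp cvg_snd valphi _ (ptws_eval_near _ _ e20).
have : \forall p \near within (H `*` [set: X]) (nbhs (h, phi)),
    `|set_val (orbit_action h phi) (i, x) -
      set_val (orbit_action p.1 p.2) (i, x)| < e.
  apply: filterS3 Hnear Vnear phinear => -[g psi] /= Hg Vg psig.
  rewrite (orbit_actionE _ Hh) (orbit_actionE _ Hg) /left_shift /=.
  have := Vphi (set_val psi) (set_mem (valP psi)) i _ _ Vg.
  by move: psig; rewrite !ltr_distl; lra.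
exact.
Qed.

(** A fixed point in the orbit closure is constant on [H] for each index; [c i] is this constant,
    and a shift of [f] approximates the fixed point at finitely many coordinates. *)
Lemma extremely_amenable_near_constant : extremely_amenable_subgroup mul one H ->
  exists c : I -> R, forall (s : seq (I * G)) (e : R), 0 < e ->
    (forall p, p \in s -> H p.2) ->
    exists2 h, H h & forall p, p \in s -> `|c p.1 - f p.1 (mul h p.2)| < e.
Proof.
move=> EA.
have [||||g h p Hg Hh||phi fixphi] := @EA X _ _ _ orbit_action.
- have cf : closure shift_orbit (fun p => f p.1 p.2).
    by apply: subset_closure; exists one => //; exact: left_shift1.
  by exists (exist (fun phi => phi \in closure shift_orbit) _ (mem_set cf)).
- exact/compact_set_type/compact_closure_orbit.
- apply: hausdorff_set_type.
  exact: (@hausdorff_product (I * G)%type (fun=> R) (fun=> @Rhausdorff R)).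
- by move=> p; apply: val_inj; have := orbit_actionE p H1; rewrite left_shift1.
- apply: val_inj; have := orbit_actionE p (HM Hg Hh); rewrite left_shiftM.
  by rewrite -(orbit_actionE p Hh) -(orbit_actionE _ Hg).
- exact: orbit_action_continuous.
exists (fun i => set_val phi (i, one)) => s e e0 Hs.
have phiE i x : H x -> set_val phi (i, x) = set_val phi (i, one).
  move=> Hx; rewrite -[in LHS](fixphi _ Hx) (orbit_actionE _ Hx).
  by rewrite /left_shift /= mulV.
have near_s : \forall psi \near (set_val phi : T),
    forall p, p \in s -> `|set_val phi p - psi p| < e.
  apply: (@filter_forall_seq _ _ _ (nbhs_filter _)) => p _.
  exact: (ptws_eval_near (set_val phi) p e0).
have [_ [[h Hh <-] hs]] := set_mem (valP phi) _ near_s.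
exists (inv h); first exact: HV.
by move=> [i x] ixs /=; rewrite -(phiE i x (Hs _ ixs)); exact: (hs (i, x) ixs).
Qed.

End OrbitClosure.

Definition ramsey_subgroup : Prop := forall U : set G, nbhs one U ->
  forall k (A : nat -> set G), (forall h, H h -> exists2 i, (i < k)%N & A i h) ->
  forall s : seq G, (forall x, x \in s -> H x) ->
  exists i h, [/\ (i < k)%N, H h & forall x, x \in s ->
    exists a, [/\ H a, A i a & U (mul (inv a) (mul h x))]].

Lemma extremely_amenable_ramsey :
  extremely_amenable_subgroup mul one H -> ramsey_subgroup.
Proof.
move=> EA U U1 k A HA s sH.
have [d [d01 d0 d1 dU]] := uniform_separation U1.
(* Intersecting with [H] ensures that the witness [a] found below lies in [H]. *)
pose f i := d (A i `&` H).
have f01 i x : 0 <= f i x <= 1 by exact: d01.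
have fU e : 0 < e -> exists2 V : set G, nbhs one V &
    forall i x y, V (mul (inv x) y) -> `|f i x - f i y| < e.
  by move=> /dU[V V1 VdU]; exists V => // i; exact: VdU.
have [c cP] := extremely_amenable_near_constant f01 fU EA.
(* Two errors below 1/2, at [one] and at [x], keep [f i (mul h x)] below 1 when [f i h = 0]. *)
have half : 0 < 2^-1 :> R by rewrite invr_gt0.
have [|h Hh hP] := cP [seq (i, x) | i <- iota 0 k, x <- one :: s] _ half.
  move=> _ /allpairsP[[i x] /= [_ + ->]] /=.
  by rewrite in_cons => /orP[/eqP->|/sH].
have {}hP i x : (i < k)%N -> x \in one :: s -> `|c i - f i (mul h x)| < 2^-1.
  move=> ik xs; apply: (hP (i, x)); apply/allpairsP; exists (i, x) => /=.
  by rewrite mem_iota add0n ik.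
have [i ik Aih] := HA _ Hh.
exists i, h; split=> // x xs.
have := hP i one ik (mem_head _ _); rewrite mulr1 /f d0 // => ci.
have := hP i x ik; rewrite in_cons xs orbT => /(_ isT) fx.
have /d1[a [Aa Ha] aU] : d (A i `&` H) (mul h x) < 1.
  by move: ci fx; rewrite /f !ltr_distl; lra.
by exists a.
Qed.

Lemma ramsey_extremely_amenable :
  ramsey_subgroup -> extremely_amenable_subgroup mul one H.
Proof.
move=> ram X [x0 _] cX hX a a1 aM ac; apply: contrapT => nofix.
have acont h x (B : set X) : H h -> nbhs (a h x) B ->
    exists (D : set G) (E : set X), [/\ nbhs h D, nbhs x E &
      forall g y, H g -> D g -> E y -> B (a g y)].
  move=> Hh Bhx; have /subspace_continuousP/(_ (h, x)) := ac.
  move=> /(_ (conj Hh I)) /(_ B Bhx)[[D E] /= [Dh Ex] DEB].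
  exists D, E; split => // g y Hg Dg Ey.
  by apply: (DEB (g, y)) => //; split.
(* For each [x], [q] holds an element moving [x], a neighbourhood of [one] of admissible errors, and
   a neighbourhood of [x] that the element moves off itself despite the errors. *)
have move_apart x : exists q : G * set G * set X,
    [/\ H q.1.1, nbhs one q.1.2, open_nbhs x q.2 &
     forall w w' y y', H w -> H w' -> q.1.2 w -> q.1.2 w' -> q.2 y -> q.2 y' ->
       a q.1.1 (a w y) <> a w' y'].
  have [h Hh hx] : exists2 h, H h & a h x <> x.
    apply: contrapT => nh; apply: nofix; exists x => h Hh.
    by apply: contrapT => hx; apply: nh; exists h.
  have := hX; rewrite open_hausdorff => /(_ (a h x) x).
  move=> [|[B C] /= [/set_mem Bx /set_mem Cx] [oB oC BC]]; first exact/eqP.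
  have [||D1 [E1 [D1h E1x DE1]]] := acont h x B; [by []|exact: open_nbhs_nbhs|].
  have [||D2 [E2 [D21 E2x DE2]]] := acont one x (C `&` E1).
  - exact: H1.
  - by rewrite a1; apply: filterI => //; exact: open_nbhs_nbhs.
  have := E2x; rewrite nbhsE => -[E oE EE2].
  exists (h, D2, E); split => //= w w' y y' Hw Hw' Dw Dw' Ey Ey' eq.
  have [_ E1wy] := DE2 _ _ Hw Dw (EE2 _ Ey).
  have [Cwy' _] := DE2 _ _ Hw' Dw' (EE2 _ Ey').
  have := DE1 _ _ Hh (nbhs_singleton D1h) E1wy; rewrite eq => Bwy'.
  by move/eqP : BC => /seteqP[/(_ (a w' y')) + _]; apply; split.
have /choice[q qP] := move_apart.
have [|s sP] := @compact_finite_subcover X (fun x => (q x).2) x0 cX.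
  by move=> x; have [] := qP x.
(* Inverses of elements of [U] are admissible errors for every member of the finite cover. *)
pose U : set G := [set w | forall x, x \in s -> (q x).1.2 (inv w)].
have U1 : nbhs one U.
  apply: filter_forall_seq => x _; have [_ qx1 _ _] := qP x.
  by have := @cvg_inv _ (nbhs one) id one _ cvg_id; rewrite inv1; apply.
pose A i : set G := [set g | (q (nth x0 s i)).2 (a (inv g) x0)].
have [h Hh||i [g [ik Hg gP]]] := ram U U1 (size s) A _
    (one :: [seq inv (q x).1.1 | x <- s]).
- have [y ys qy] := sP (a (inv h) x0).
  by exists (index y s); [rewrite index_mem|rewrite /A /= nth_index].
- move=> x; rewrite in_cons => /orP[/eqP->//|/mapP[y _ ->]].
  by apply: HV; have [] := qP y.
have xs : nth x0 s i \in s by exact: mem_nth.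
set x := nth x0 s i in xs *.
have [Hx _ _ xP] := qP x.
(* Writes [z^-1 x0] as the error [(b^-1 z)^-1] applied to [b^-1 x0], which lies in the [i]-th set of
   the cover when [b] has colour [i]. *)
have translate b z : H b -> H z -> a (inv z) x0 =
    a (inv (mul (inv b) z)) (a (inv b) x0).
  move=> Hb Hz; rewrite -aM ?invM ?invK -?mulA ?mulrV ?mulr1 //; last exact: HV.
  by apply: HM => //; exact: HV.
have [b [Hb Ab]] := gP _ (mem_head _ _); rewrite mulr1 => Ub.
have [|b' [Hb' Ab' Ub']] := gP (inv (q x).1.1).
  by rewrite in_cons map_f ?orbT.
have Hgx : H (mul g (inv (q x).1.1)) by apply: HM => //; exact: HV.
(* With [h = (q x).1.1], both sides equal [h g^-1 x0]: one as [h] applied to [g^-1 x0], the other as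
   [(g h^-1)^-1 x0]. *)
apply: (xP _ _ _ _ _ _ (Ub _ xs) (Ub' _ xs) Ab Ab').
- by apply/HV/HM => //; exact: HV.
- by apply/HV/HM => //; exact: HV.
rewrite -!translate // invM invK aM //; exact: HV.
Qed.

End Oscillation.

(** * The Ramsey property as a condition on homomorphisms *)

Section Homomorphisms.
Context {Gam : Type} {gmul : Gam -> Gam -> Gam} {ginv : Gam -> Gam} {gone : Gam}.
Hypothesis gG : group_axioms gmul ginv gone.
Variable e : nat -> Gam.
Hypothesis e_surj : forall x, exists n, e n = x.

(* Only finitely many pairs of values of [pi] are compared, because [m] and [j]
   are bounded by [N]; this is what makes the condition open in [pi]. *)
Definition finite_ramsey (V : set G) (k : nat) (s : seq nat) (pi : Gam -> G) :=
  exists N, forall c : Gam -> nat, (forall x, (c x < k)%N) ->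
  exists m i, (m < N)%N /\ forall t, t \in s -> exists j,
    [/\ (j < N)%N, c (e j) = i &
      V (mul (inv (pi (e j))) (pi (gmul (e m) (e t))))].

Lemma open_finite_ramsey V k s : open V ->
  open (finite_ramsey V k s : set {ptws Gam -> G}).
Proof.
move=> oV; rewrite openE => pi [N piN].
(* An implication suffices, since membership in [V] occurs only positively in [finite_ramsey]. *)
have near_pi a b : \forall rho \near (pi : {ptws Gam -> G}),
    V (mul (inv (pi a)) (pi b)) -> V (mul (inv (rho a)) (rho b)).
  have [Vpi|nVpi] := pselect (V (mul (inv (pi a)) (pi b))); last first.
    by apply: (@filterE _ _ (nbhs_filter _)) => rho /nVpi.
  have : mul (inv (rho a)) (rho b) @[rho --> (pi : {ptws Gam -> G})] -->
      mul (inv (pi a)) (pi b).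
    have /ptws_cvgP pi_cvg : {ptws, nbhs pi --> pi} by [].
    exact: (cvg_mul _ (cvg_inv _ (pi_cvg a)) (pi_cvg b)).
  move=> /(_ V (open_nbhs_nbhs (conj oV Vpi))).
  by apply: (@filterS _ _ (nbhs_filter _)).
have near_all : \forall rho \near (pi : {ptws Gam -> G}),
    forall j, j \in iota 0 N -> forall m, m \in iota 0 N -> forall t, t \in s ->
    V (mul (inv (pi (e j))) (pi (gmul (e m) (e t)))) ->
    V (mul (inv (rho (e j))) (rho (gmul (e m) (e t)))).
  do 3![apply: (@filter_forall_seq _ _ _ (nbhs_filter _)) => ? _].
  exact: near_pi.
apply: (@filterS _ _ (nbhs_filter _) _ _ _ near_all) => rho near_rho.
exists N => c ck.
have [m [i [mN sP]]] := piN c ck; exists m, i; split=> // t ts.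
have [j [jN cj Vj]] := sP t ts; exists j; split=> //.
by apply: near_rho; rewrite ?mem_iota.
Qed.

Variable pi : Gam -> G.
Hypothesis piM : forall a b, pi (gmul a b) = mul (pi a) (pi b).

Lemma hom1 : pi gone = one.
Proof.
case: gG => _ g1 _ _ _.
by rewrite -[LHS](mulVK (pi gone)) -piM g1 mulV.
Qed.

Lemma homV a : pi (ginv a) = inv (pi a).
Proof.
case: gG => _ _ _ _ gV.
by rewrite -[LHS](mulVK (pi a)) -piM gV hom1 mulr1.
Qed.

Lemma ramsey_finite_ramsey V k s : nbhs one V ->
  ramsey_subgroup (range pi) -> finite_ramsey V k s pi.
Proof.
move=> V1 ram; apply: contrapT => /forallNP nfin.
have /choice[c cP] : forall N, exists c : Gam -> nat, (forall x, (c x < k)%N) /\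
    ~ exists m i, (m < N)%N /\ forall t, t \in s -> exists j,
      [/\ (j < N)%N, c (e j) = i &
        V (mul (inv (pi (e j))) (pi (gmul (e m) (e t))))].
  by move=> N; have /existsNP[c /not_implyP[ck cN]] := nfin N; exists c.
(* A limit [c'] of the bad colourings [c N] along an ultrafilter is a colouring
   of all of [Gam] to which the Ramsey property applies. *)
have [F [FU Foo]] := ultraFilterLemma (F := \oo) _.
have /choice[c' c'P] : forall x, exists i, (i < k)%N /\ F [set N | c N x = i].
  move=> x.
  have [|i ik Fi] := ultra_finite_partition (c := fun N => c N x) FU (k := k).
    by move=> N; have [] := cP N.
  by exists i.
(* The images under [pi] of the classes of [c'] may overlap when [pi] is not injective; the Ramsey
   property allows this, being stated for coverings. *)
have [_ [x _ <-]||i [_ [ik [x _ <-] xP]]] := ram V V1 k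
    (fun i => [set pi x | x in [set x | c' x = i]]) _ [seq pi (e t) | t <- s].
- by exists (c' x); [have [] := c'P x|exists x].
- by move=> _ /mapP[t _ ->]; exists (e t).
have [m em] := e_surj x.
(* [F] contains all tails, so [F]-almost every [N] exceeds [m] and the finitely many [j] at hand;
   any such [N] contradicts the choice of [c N]. *)
have Flt n : F [set N | (n < N)%N] by apply: Foo; exact: nbhs_infty_gt.
have Fs : F [set N | forall t, t \in s -> exists j,
    [/\ (j < N)%N, c N (e j) = i &
      V (mul (inv (pi (e j))) (pi (gmul (e m) (e t))))]].
  apply: filter_forall_seq => t ts.
  have [|_ [_ [y /= c'y <-] Vy]] := xP (pi (e t)); first exact: map_f.
  have [j ej] := e_surj y.
  have [_ Fy] := c'P y.
  apply: filterS2 (Flt j) Fy => N jN cN; exists j; split=> //.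
    by rewrite ej cN.
  by rewrite ej em piM.
have [N [mN NP]] := filter_ex (filterI (Flt m) Fs).
by have [_] := cP N; apply; exists m, i.
Qed.

Lemma finite_ramsey_ramsey (V : nat -> set G) :
  (forall U, nbhs one U -> exists n, V n `<=` U) ->
  (forall n k s, finite_ramsey (V n) k s pi) -> ramsey_subgroup (range pi).
Proof.
move=> Vbasis fin U /Vbasis[n VU] k A HA s sH.
have /choice[c cP] : forall x, exists i, (i < k)%N /\ A i (pi x).
  by move=> x; have [|i ik Ai] := HA (pi x); [exists x|exists i].
have /choice[r rP] : forall y, exists j, range pi y -> pi (e j) = y.
  move=> y; have [[x _ <-]|ny] := pselect (range pi y); last by exists 0%N.
  by have [j ej] := e_surj x; exists j; rewrite ej.
have [N finN] := fin n k (map r s).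
have [|m [i [_ mP]]] := finN c; first by move=> x; have [] := cP x.
(* [finite_ramsey] does not bound the colour [i]: for nonempty [s] the bound comes from
   [c (e j) = i], and for empty [s] any colour in use will do. *)
have [s0|[x0 x0s]] : s = [::] \/ exists x, x \in s.
  by case: (s) => [|x t]; [left|right; exists x; exact: mem_head].
  by exists (c gone), (pi gone); split; [have [] := cP gone|exists gone|rewrite s0].
have [j [_ cj _]] := mP (r x0) (map_f r x0s).
exists i, (pi (e m)); split; [by rewrite -cj; have [] := cP (e j)|by exists (e m)|].
move=> x xs; have [j' [_ cj' Vj']] := mP (r x) (map_f r xs).
exists (pi (e j')); split; first by exists (e j').
  by rewrite -cj'; have [] := cP (e j').
by apply: VU; rewrite -(rP x (sH x xs)) -piM.
Qed.

Lemma extremely_amenable_range (V : nat -> set G) :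
  (forall n, nbhs one (V n)) ->
  (forall U, nbhs one U -> exists n, V n `<=` U) ->
  extremely_amenable_subgroup mul one (range pi) <->
  forall n k s, finite_ramsey (V n) k s pi.
Proof.
move=> V1 Vbasis.
have H1 : range pi one by exists gone => //; exact: hom1.
have HM x y : range pi x -> range pi y -> range pi (mul x y).
  by move=> [a _ <-] [b _ <-]; exists (gmul a b).
have HV x : range pi x -> range pi (inv x).
  by move=> [a _ <-]; exists (ginv a) => //; exact: homV.
split=> [EA n k s|fin].
  exact/ramsey_finite_ramsey/extremely_amenable_ramsey.
exact/ramsey_extremely_amenable/(finite_ramsey_ramsey Vbasis).
Qed.

End Homomorphisms.
End TopologicalGroup.

(** * The countable intersection of open conditions *)

Theorem theorem3p1
  (G : topologicalType) (mul : G -> G -> G) (inv : G -> G) (one : G)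
  (Gam : Type) (gmul : Gam -> Gam -> Gam) (ginv : Gam -> Gam) (gone : Gam) :
  polish_group mul inv one ->
  group_axioms gmul ginv gone ->
  countable [set: Gam] ->
  G_delta_in (hom_set gmul mul)
    [set pi : {ptws Gam -> G} | hom_set gmul mul pi /\
       extremely_amenable_subgroup mul one (range pi)].
Proof.
move=> [tG [_ [d [dG _]]]] gG cGam.
have [e e_surj] := countable_enum gone cGam.
have [V [oV Vbasis]] := compatible_metric_ball_basis one dG.
have V1 n : nbhs one (V n) by exact: open_nbhs_nbhs.
(* The triples [(n, k, s)] are enumerated by their codes; a number that codes none contributes the
   whole space. *)
pose U m : set {ptws Gam -> G} :=
  if unpickle m is Some (n, k, s) then
    finite_ramsey (mul := mul) (inv := inv) (gmul := gmul) e (V n) k s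
  else setT.
exists U; split=> [m|].
  rewrite /U; case: (unpickle m : option (nat * nat * seq nat)) => [[[n k] s]|].
    by apply: (open_finite_ramsey tG); have [] := oV n.
  exact: openT.
apply/seteqP; split=> pi [pihom].
  move=> /(extremely_amenable_range tG gG e_surj pihom V1 Vbasis) fin.
  split=> // m _; rewrite /U.
  by case: (unpickle m : option (nat * nat * seq nat)) => [[[n k] s]|//].
move=> piU; split=> //.
apply/(extremely_amenable_range tG gG e_surj pihom V1 Vbasis) => n k s.
by have := piU (pickle (n, k, s)) Logic.I; rewrite /U pickleK.
Qed.
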